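(* The Boolean lattice $\mathcal{B}_4$ of order $4$ satisfies $\operatorname{ldim}(\mathcal{B}_4)\leq 3$.
   Context: A poset is a pair $P=(X,\leq)$ where $X$ is a non-empty set and $\leq$ is a reflexive, antisymmetric, transitive relation on $X$. A poset $Q$ is a subposet of $P$ if the ground set of $Q$ is a subset of that of $P$ and the order of $Q$ is the restriction of the order of $P$. A linear extension of $P$ is a linear order $L$ on the ground set of $P$ such that $x\leq_L y$ whenever $x\leq_P y$. A partial linear extension of $P$ is a linear extension of a subposet of $P$. A local realizer of $P$ is a family $\mathcal{L}$ of partial linear extensions of $P$ such that for all $x,y\in P$ there exists $L\in\mathcal{L}$ with $x,y\in L$, and $x\leq_P y$ if and only if there is no $L\in\mathcal{L}$ with $y<_L x$. The frequency of an element $x\in P$ in $\mathcal{L}$ is the number of $L\in\mathcal{L}$ with $x\in L$ (i.e. $x$ is in the ground set of $L$); the frequency of $\mathcal{L}$ is the maximum frequency of an element of $P$ in $\mathcal{L}$. The local dimension $\operatorname{ldim}(P)$ is the minimum frequency of a local realizer of $P$. For a positive integer $n$, the Boolean lattice $\mathcal{B}_n$ is the poset of all subsets of $[n]=\{1,\dots,n\}$ ordered by inclusion. *)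

(* Defs.v *)
#[warnings="-notation-overridden"]
From mathcomp Require Import all_boot all_order.

Set Implicit Arguments.
Unset Strict Implicit.
Unset Printing Implicit Defensive.

Import Order.TTheory.
Local Open Scope order_scope.

Section LocalDimension.
Context {d : Order.disp_t} {T : finPOrderType d}.

(* [is_linear_order A R]: A is non-empty (posets are non-empty) and R is the
   graph of a linear order on A. The second conjunct confines R to A x A, so
   that a linear order is represented by exactly one pair (A, R). *)
Definition is_linear_order (A : {set T}) (R : {set T * T}) : bool :=
  [&& A != set0,
      R \subset setX A A,
      [forall x in A, (x, x) \in R],
      [forall x in A, forall y in A,
         ((x, y) \in R) && ((y, x) \in R) ==> (x == y)],
      [forall x in A, forall y in A, forall z in A,
         ((x, y) \in R) && ((y, z) \in R) ==> ((x, z) \in R)] &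
      [forall x in A, forall y in A, ((x, y) \in R) || ((y, x) \in R)]].

(* R is a linear extension of the subposet of T with ground set A. *)
Definition is_partial_linear_extension (L : {set T} * {set T * T}) : bool :=
  is_linear_order L.1 L.2 &&
  [forall x in L.1, forall y in L.1, (x <= y) ==> ((x, y) \in L.2)].

Definition ple := {L : {set T} * {set T * T} | is_partial_linear_extension L}.

Definition ground (L : ple) : {set T} := (val L).1.

Definition ple_le (L : ple) (x y : T) : bool := (x, y) \in (val L).2.

Definition ple_lt (L : ple) (x y : T) : bool := (x != y) && ple_le L x y.

(* Families are taken to be finite sets: T has only finitely many partial
   linear extensions, and repeating one in a family cannot decrease the
   frequencies. *)
Definition is_local_realizer (F : {set ple}) : bool :=
  [forall x, forall y,
     [exists L in F, (x \in ground L) && (y \in ground L)] &&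
     ((x <= y) == ~~ [exists L in F, ple_lt L y x])].

Definition elt_frequency (F : {set ple}) (x : T) : nat :=
  #|[set L in F | x \in ground L]|.

Definition frequency (F : {set ple}) : nat :=
  (\max_(x : T) elt_frequency F x)%N.

End LocalDimension.

Arguments ple {d} T.

(* The default value [setT] is itself a local realizer ([local_realizerT]), so
   this is a genuine minimum ([ldim_attained], [ldim_min]). *)
Definition ldim {d : Order.disp_t} (T : finPOrderType d) : nat :=
  frequency
    [arg min_(F < [set: ple T] | is_local_realizer F) frequency F]%N.

Section LdimMinimum.
Context {d : Order.disp_t} {T : finPOrderType d}.

Let pairR (a b : T) : {set T * T} := [set (a, a); (b, b); (a, b)].

Lemma pair_ple (a b : T) : (b <= a -> a = b) ->
  is_partial_linear_extension ([set a; b], pairR a b).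
Proof.
rewrite /pairR => ab; apply/andP; split; last first.
  apply/forall_inP => x; rewrite /= !inE => xP; apply/forall_inP => y.
  rewrite /= !inE => yP; apply/implyP; rewrite /= ?inE !xpair_eqE.
  by case/orP: xP yP => /eqP-> /orP[]/eqP->; rewrite ?eqxx ?orbT // => /ab->;
    rewrite eqxx.
apply/and5P; split; last (apply/andP; split).
- by apply/set0Pn; exists a; rewrite !inE eqxx.
- by apply/subsetP => -[x y]; rewrite !inE => /orP[/orP[]|] /andP[/= /eqP-> /eqP->];
    rewrite !eqxx ?orbT.
- by apply/forall_inP => x; rewrite /= !inE => /orP[]/eqP->; rewrite !xpair_eqE !eqxx ?orbT.
- apply/forall_inP => x; rewrite /= !inE => xP; apply/forall_inP => y.
  rewrite /= !inE => yP; apply/implyP; rewrite /= ?inE !xpair_eqE.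
  by case/orP: xP yP => /eqP-> /orP[]/eqP->; rewrite ?eqxx //= ?(eq_sym b a);
    case: (a == b) => //.
- apply/forall_inP => x; rewrite /= !inE => xP; apply/forall_inP => y.
  rewrite /= !inE => yP; apply/forall_inP => z; rewrite /= !inE => zP.
  apply/implyP; rewrite /= ?inE !xpair_eqE.
  by case/orP: xP yP zP => /eqP-> /orP[]/eqP-> /orP[]/eqP->;
    rewrite ?eqxx //= ?(eq_sym b a); case: (a == b) => //.
- apply/forall_inP => x; rewrite /= !inE => xP; apply/forall_inP => y.
  rewrite /= !inE => yP; rewrite ?inE !xpair_eqE.
  by case/orP: xP yP => /eqP-> /orP[]/eqP->; rewrite ?eqxx ?orbT.
Qed.

Lemma ple_pair (a b : T) : (b <= a -> a = b) ->
  exists L : ple T, [/\ a \in ground L, b \in ground L & ple_le L a b].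
Proof.
move=> ab; exists (Sub _ (pair_ple ab)).
by rewrite /ground /ple_le SubK /= !inE !eqxx !orbT.
Qed.

Lemma local_realizerT : is_local_realizer [set: ple T].
Proof.
apply/forallP => x; apply/forallP => y; apply/andP; split.
  have [le_yx|nle_yx] := boolP (y <= x).
    have p : x <= y -> y = x by move=> le_xy; apply/le_anti; rewrite le_yx.
    have [L [yL xL _]] := ple_pair p.
    by apply/exists_inP; exists L; rewrite ?inE // xL.
  have p : y <= x -> x = y by rewrite (negPf nle_yx).
  have [L [xL yL _]] := ple_pair p.
  by apply/exists_inP; exists L; rewrite ?inE // xL.
have [le_xy|nle_xy] := boolP (x <= y).
  rewrite eq_sym eqb_id; apply/exists_inP => -[[[A R] LP]] _ /andP[/negP neq].
  rewrite /ple_le /=; have /andP[/and5P[/= _ /subsetP RA _ anti _] ext] := LP => yx; apply: neq.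
  have := RA _ yx; rewrite !inE /= => /andP[yA xA].
  move/forall_inP/(_ _ xA)/forall_inP/(_ _ yA): ext; rewrite le_xy /= => xyR.
  move/forall_inP/(_ _ yA)/forall_inP/(_ _ xA): anti.
  by rewrite yx xyR.
rewrite eq_sym eqbF_neg negbK.
have p : x <= y -> y = x by rewrite (negPf nle_xy).
have [L [yL xL yx]] := ple_pair p.
apply/exists_inP; exists L; rewrite ?inE // /ple_lt yx andbT.
by apply: contraNneq nle_xy => ->.
Qed.

Lemma ldim_attained :
  exists2 F : {set ple T}, is_local_realizer F & frequency F = ldim T.
Proof.
by rewrite /ldim; case: arg_minnP => [|F FP _]; [exact: local_realizerT | exists F].
Qed.

Lemma ldim_min (F : {set ple T}) : is_local_realizer F -> (ldim T <= frequency F)%N.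
Proof.
move=> FP; rewrite /ldim; case: arg_minnP => [|G _]; first exact: local_realizerT.
exact.
Qed.

End LdimMinimum.

Import Order.DefaultSetSubsetOrder.

(* The ground set [n] is taken to be 'I_n = {0, ..., n-1}. *)
Definition boolean_lattice (n : nat) :
    finPOrderType Order.SetSubsetOrder.subset_display :=
  {set 'I_n}.

Lemma boolean_latticeE (n : nat) (A B : boolean_lattice n) :
  (A <= B) = (A \subset (B : {set 'I_n})).
Proof. by []. Qed.

(* Main.v *)
Require Import Defs.
From mathcomp Require Import all_boot all_order.

Set Implicit Arguments.
Unset Strict Implicit.
Unset Printing Implicit Defensive.

(** Reversing a pair [(A, B)] means placing [A] above [B] although [A] is not
above [B] in the lattice. The hard pairs of B_4 are the four pairs
[({i}, [4] - {i})]: a linear extension reverses at most one of them, because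
reversing those of [i] and [j] would give
[[4] - {i} < {i} < [4] - {j} < {j} < [4] - {i}]. This forces at least four
partial linear extensions, and [family4] uses exactly four, one for each
[i]. If the four were orders of the whole lattice, every set would have
frequency 4. The point is that they can be thinned out: every subset of [[4]] is
left out of exactly one of them, so its frequency is 3. Any two subsets still share at least two lists, which leaves
room for both orders of an incomparable pair to occur. That they all do occur
is a finite check.

For this check to compute, a set is named by the numeral whose decimal digits
are its elements: 134 for [{1, 3, 4}] and 0 for the empty set. Lemma
[ldim_listed] reduces the bound to statements about the positions of names in
the lists, and [family4_good] decides these for all pairs of subsets, each
given by its four membership bits. *)

Section Listed.
Context {d : Order.disp_t} {T : finPOrderType d} {K : eqType}.
Variable name : T -> K.
Hypothesis name_inj : injective name.

Definition listed (s : seq K) : {set T} * {set T * T} :=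
  ([set x | name x \in s],
   [set p | [&& name p.1 \in s, name p.2 \in s &
                (index (name p.1) s <= index (name p.2) s)%N]]).

(** Comparison of positions is total and transitive, and antisymmetric because
names are injective, so only compatibility with the order of [T] remains. *)
Lemma listed_is_ple (s : seq K) :
  (exists x, name x \in s) ->
  (forall x y, name x \in s -> name y \in s -> (x <= y)%O ->
     (index (name x) s <= index (name y) s)%N) ->
  is_partial_linear_extension (listed s).
Proof.
move=> [x0 x0s] mono; apply/andP; split; last first.
  apply/forall_inP => x; rewrite inE => xs; apply/forall_inP => y.
  by rewrite inE => ys; apply/implyP => xy; rewrite inE /= xs ys mono.
apply/and5P; split; last (apply/andP; split).
- by apply/set0Pn; exists x0; rewrite inE.
- by apply/subsetP => -[x y]; rewrite !inE /= => /and3P[-> ->].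
- by apply/forall_inP => x; rewrite !inE /= => ->; rewrite leqnn.
- apply/forall_inP => x; rewrite inE => xs; apply/forall_inP => y.
  rewrite inE => ys; apply/implyP; rewrite !inE /= xs ys /= -eqn_leq.
  by move=> /eqP idx; apply/eqP; exact: name_inj (index_inj (name x) xs ys idx).
- apply/forall_inP => x; rewrite inE => xs; apply/forall_inP => y.
  rewrite inE => ys; apply/forall_inP => z; rewrite inE => zs.
  apply/implyP; rewrite !inE /= xs ys zs /=.
  by move=> /andP[]; exact: leq_trans.
- apply/forall_inP => x; rewrite inE => xs; apply/forall_inP => y.
  by rewrite inE => ys; rewrite !inE /= xs ys leq_total.
Qed.

(** Two lists may define the same partial linear extension; this only lowers
frequencies, so counting lists bounds them from above. *)
Lemma ldim_listed (ss : seq (seq K)) (k : nat) :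
  (forall s, s \in ss -> exists x, name x \in s) ->
  (forall s x y, s \in ss -> name x \in s -> name y \in s -> (x <= y)%O ->
     (index (name x) s <= index (name y) s)%N) ->
  (forall x y, has (fun s => (name x \in s) && (name y \in s)) ss) ->
  (forall x y, ~~ (x <= y)%O ->
     has (fun s => (name x \in s) &&
                   (index (name y) s < index (name x) s)%N) ss) ->
  (forall x, (count (fun s => name x \in s) ss <= k)%N) ->
  (ldim T <= k)%N.
Proof.
move=> ne mono meet rev freq.
pose F := [set L : ple T | val L \in map listed ss].
have inF s : s \in ss -> exists2 L : ple T, L \in F & val L = listed s.
  move=> sss; have sP : is_partial_linear_extension (listed s).
    by apply: listed_is_ple => [|x y]; [exact: ne | exact: mono].
  by exists (Sub (listed s) sP); rewrite // inE; exact: map_f.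
have realF : is_local_realizer F.
  apply/forallP => x; apply/forallP => y; apply/andP; split.
    have /hasP[s /inF[L LF LE] /andP[xs ys]] := meet x y.
    by apply/exists_inP; exists L; rewrite // /ground LE !inE xs ys.
  have [xy|/rev/hasP[s /inF[L LF LE] /andP[xs yx]]] := boolP (x <= y)%O.
    rewrite eq_sym eqb_id; apply/exists_inP => -[L].
    rewrite inE => /mapP[s sss LE] /andP[/eqP nyx].
    rewrite /ple_le LE !inE /= => /and3P[ys xs yx]; apply: nyx.
    apply: name_inj; apply: (index_inj (name y) ys xs).
    by apply/eqP; rewrite eqn_leq yx (mono s).
  rewrite eq_sym eqbF_neg negbK; apply/exists_inP; exists L => //.
  have ys : name y \in s by rewrite -index_mem (ltn_trans yx) // index_mem.
  rewrite /ple_lt /ple_le LE inE /= xs ys (ltnW yx) !andbT.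
  by apply: contraTneq yx => ->; rewrite ltnn.
apply: leq_trans (ldim_min realF) _; apply/bigmax_leqP => x _.
apply: leq_trans (freq x); rewrite /elt_frequency cardE -(size_map val).
rewrite -size_filter -(size_map listed).
apply: uniq_leq_size => [|l /mapP[L]]; first by rewrite (map_inj_uniq val_inj) enum_uniq.
rewrite mem_enum !inE => /andP[/mapP[s sss LE] xL] ->.
by rewrite LE map_f // mem_filter sss; move: xL; rewrite /ground LE inE andbT.
Qed.

End Listed.

Definition digits (a : bool * bool * bool * bool) : nat :=
  let: (a1, a2, a3, a4) := a in
  let snoc (b : bool) (d n : nat) := if b then 10 * n + d else n in
  snoc a4 4 (snoc a3 3 (snoc a2 2 (snoc a1 1 0))).

(** The element [i] of [[4]] is the ordinal [i - 1], so [mem 0] decides whether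
the digit 1 occurs. *)
Definition mems (A : boolean_lattice 4) : bool * bool * bool * bool :=
  let mem i := (inord i : 'I_4) \in (A : {set 'I_4}) in
  (mem 0, mem 1, mem 2, mem 3).

Definition bits_le (a b : bool * bool * bool * bool) : bool :=
  let: (a1, a2, a3, a4) := a in let: (b1, b2, b3, b4) := b in
  [&& a1 ==> b1, a2 ==> b2, a3 ==> b3 & a4 ==> b4].

(** In these lists, 4 is above 123, 1 is above 234, 3 is above 124 and 2 is
above 134, respectively. *)
Definition family4 : seq (seq nat) :=
  [:: [:: 1; 12; 3; 13; 23; 123; 4; 34; 234; 14; 134; 1234];
      [:: 0; 3; 4; 34; 2; 23; 24; 234; 1; 12; 124; 13; 1234];
      [:: 0; 2; 4; 24; 14; 124; 3; 34; 134; 23; 234; 123; 1234];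
      [:: 0; 1; 14; 13; 134; 2; 12; 123; 24; 124]].

Lemma le_mems (A B : boolean_lattice 4) : (A <= B)%O = bits_le (mems A) (mems B).
Proof.
rewrite boolean_latticeE; apply/subsetP/and4P => [AB|[AB0 AB1 AB2 AB3] i].
  by split; apply/implyP; exact: AB.
rewrite -[i]inord_val; case: i => -[|[|[|[|//]]]] /= _; exact/implyP.
Qed.

Lemma digits_inj : injective digits.
Proof. by move=> [[[[] []] []] []] [[[[] []] []] []] /eqP; vm_compute. Qed.

Lemma mems_inj : injective mems.
Proof.
move=> A B AB; apply: Order.le_anti; rewrite !le_mems AB andbb.
by rewrite -le_mems.
Qed.

Definition name (A : boolean_lattice 4) : nat := digits (mems A).

(** What [ldim_listed] asks of two names, with inclusion read off the bits: no
finite set is left, so it can be evaluated. *)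
Definition good_pair (a b : bool * bool * bool * bool) : bool :=
  let x := digits a in let y := digits b in
  [&& all (fun s => [&& x \in s, y \in s & bits_le a b] ==>
                    (index x s <= index y s)%N) family4,
      has (fun s => (x \in s) && (y \in s)) family4,
      ~~ bits_le a b ==>
        has (fun s => (x \in s) && (index y s < index x s)%N) family4 &
      (count (fun s => x \in s) family4 <= 3)%N].

Lemma family4_good a b : good_pair a b.
Proof.
by move: a b => [[[a1 a2] a3] a4] [[[b1 b2] b3] b4];
  case: a1 a2 a3 a4 b1 b2 b3 b4 => [] [] [] [] [] [] [] []; vm_compute.
Qed.

Theorem lemma7 : (ldim (boolean_lattice 4) <= 3)%N.
Proof.
have good (A B : boolean_lattice 4) := family4_good (mems A) (mems B).
apply: (@ldim_listed _ _ _ name _ family4).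
- exact: inj_comp digits_inj mems_inj.
- have name0 : name set0 = 0 by rewrite /name /mems !inE.
  have nameT : name [set: 'I_4] = 1234 by rewrite /name /mems !inE.
  move=> s; rewrite !inE => /or4P[] /eqP->.
  + by exists [set: 'I_4]; rewrite nameT.
  + by exists [set: 'I_4]; rewrite nameT.
  + by exists [set: 'I_4]; rewrite nameT.
  + by exists set0; rewrite name0.
- move=> s A B sF As Bs; rewrite le_mems => AB.
  have /and4P[/allP/(_ s sF)/implyP mono _ _ _] := good A B.
  by apply: mono; rewrite As Bs.
- by move=> A B; case/and4P: (good A B).
- by move=> A B; rewrite le_mems => AB; case/and4P: (good A B) => _ _ /implyP/(_ AB).
- by move=> A; case/and4P: (good A A).
Qed.
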